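(* Let $\mathfrak{g}_0$ be a compact semisimple Lie algebra, $\mathfrak{g}=\mathfrak{g}_0\otimes_{\mathbb{R}}\mathbb{C}$, and let $A$ be a $(\ast)$-subgroup of $G=\mathrm{Aut}(\mathfrak{g}_0)$. Then both $\mathfrak{g}_{\infty}$ and $\mathfrak{g}_{f}$ are $A$-ideals of $\mathfrak{g}$, and $$\mathfrak{g}=\mathfrak{g}_{\infty}\oplus\mathfrak{g}_{f}.$$
   Context: A $(\ast)$-subgroup of a compact Lie group $G$ is a closed abelian subgroup $A$ with $\dim Z_G(A)=\dim A$. $A^0$ is the identity component of $A$, $X^*(A)=\mathrm{Hom}(A,\mathrm{U}(1))$ written additively. For $\lambda\in X^*(A)$, $\mathfrak{g}_\lambda=\{Y\in\mathfrak{g}: a\cdot Y=\lambda(a)Y\ \forall a\in A\}$, and $R(G,A)=\{\alpha\in X^*(A)-\{0\}:\mathfrak{g}_\alpha\neq0\}$. Put $R'(G,A)=\{\alpha|_{A^0}:\alpha\in R(G,A),\ \alpha|_{A^0}\ne0\}$ and, for $\alpha'\in R'(G,A)$, $\mathfrak{g}'_{\alpha'}=\bigoplus_{\alpha\in R(G,A),\,\alpha|_{A^0}=\alpha'}\mathfrak{g}_\alpha$. Define $$\mathfrak{g}_\infty=\Big(\bigoplus_{\alpha'\in R'(G,A)}\mathfrak{g}'_{\alpha'}\Big)\oplus\Big(\sum_{\alpha'\in R'(G,A)}[\mathfrak{g}'_{\alpha'},\mathfrak{g}'_{-\alpha'}]\Big),$$ and let $\mathfrak{g}_f$ be the centralizer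 of $\mathfrak{g}_\infty$ in $\mathfrak{g}$. An $A$-ideal of $\mathfrak{g}$ is a (complex) ideal of $\mathfrak{g}$ stable under the action of $A$. *)

(* Defs.v *)
From HB Require Import structures.
From mathcomp Require Import all_boot all_order all_algebra.
From mathcomp Require Import complex.
From mathcomp Require Import all_classical all_reals all_analysis.
Set Implicit Arguments.
Unset Strict Implicit.
Unset Printing Implicit Defensive.
Import Order.TTheory GRing.Theory Num.Theory.
Import passmx numFieldNormedType.Exports.
Local Open Scope classical_set_scope.
Local Open Scope ring_scope.
Local Open Scope complex_scope.

HB.mixin Record Lmodule_isLie (K : comNzRingType) L of GRing.Lmodule K L := {
  lie : L -> L -> L;
  lie_linearl : forall (k : K) (x y z : L),
    lie (k *: x + y) z = k *: lie x z + lie y z;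
  lie_linearr : forall (k : K) (x y z : L),
    lie z (k *: x + y) = k *: lie z x + lie z y;
  lie_alt : forall x : L, lie x x = 0;
  lie_jacobi : forall x y z : L,
    lie x (lie y z) + lie y (lie z x) + lie z (lie x y) = 0 }.

#[short(type="lieAlgType")]
HB.structure Definition LieAlgebra (K : comNzRingType) :=
  {L of Lmodule_isLie K L & GRing.Lmodule K L}.

#[short(type="vectLieType")]
HB.structure Definition VectLie (K : comNzRingType) :=
  {L of LieAlgebra K L & Vector K L}.

Section LieTheory.
Variables (K : comNzRingType) (L : lieAlgType K).
Implicit Types x y z : L.

Lemma lieDl x y z : lie (x + y) z = lie x z + lie y z.
Proof. by have := lie_linearl 1 x y z; rewrite !scale1r. Qed.

Lemma lieDr x y z : lie z (x + y) = lie z x + lie z y.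
Proof. by have := lie_linearr 1 x y z; rewrite !scale1r. Qed.

Lemma lie0l z : lie 0 z = 0.
Proof. by apply: (addrI (lie 0 z)); rewrite -lieDl !addr0. Qed.

Lemma lie0r z : lie z 0 = 0.
Proof. by apply: (addrI (lie z 0)); rewrite -lieDr !addr0. Qed.

Lemma lieZl k x z : lie (k *: x) z = k *: lie x z.
Proof. by have := lie_linearl k x 0 z; rewrite lie0l !addr0. Qed.

Lemma lieZr k x z : lie z (k *: x) = k *: lie z x.
Proof. by have := lie_linearr k x 0 z; rewrite lie0r !addr0. Qed.

Lemma lieNl x z : lie (- x) z = - lie x z.
Proof. by rewrite -!scaleN1r lieZl. Qed.

Lemma lieNr x z : lie z (- x) = - lie z x.
Proof. by rewrite -!scaleN1r lieZr. Qed.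

Lemma lieC x y : lie x y = - lie y x.
Proof.
apply/eqP; rewrite -addr_eq0; have := lie_alt (x + y).
by rewrite lieDl !lieDr !lie_alt add0r addr0 => ->.
Qed.

End LieTheory.

(* [complexification g0] is the tensor product of g0 with the complex numbers;
   the pair (x, y) stands for x (x) 1 + y (x) i. *)
Definition complexification (R : realType) (g0 : lieAlgType R) : Type :=
  (g0 * g0)%type.

Section Complexification.
Variables (R : realType) (g0 : lieAlgType R).
Local Notation g := (complexification g0).

HB.instance Definition _ := GRing.Zmodule.copy g (g0 * g0)%type.

Definition complex_scale (k : R[i]) (x : g) : g :=
  (complex.Re k *: x.1 - complex.Im k *: x.2,
   complex.Re k *: x.2 + complex.Im k *: x.1).

Lemma complex_scaleA k l x : complex_scale k (complex_scale l x) = complex_scale (k * l) x.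
Proof.
case: k l x => [a b] [c d] [x y]; congr pair => /=.
  rewrite scalerBr scalerDr !scalerA scalerBl scalerDl !opprD.
  by rewrite [- _ - _ in LHS]addrC addrACA.
rewrite scalerBr scalerDr !scalerA scalerBl scalerDl.
by rewrite [_ - _ in LHS]addrC addrACA.
Qed.

Lemma complex_scale1 x : complex_scale 1 x = x.
Proof. by case: x => x y; rewrite /complex_scale /= !scale1r !scale0r subr0 addr0. Qed.

Lemma complex_scaleDr : right_distributive complex_scale +%R.
Proof.
move=> [a b] [x y] [x' y']; congr pair; rewrite /= !scalerDr.
  by rewrite opprD addrACA.
by rewrite addrACA.
Qed.

Lemma complex_scaleDl x : {morph complex_scale^~ x : k l / k + l}.
Proof.
case: x => x y [a b] [c d]; congr pair; rewrite /= !scalerDl.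
  by rewrite opprD addrACA.
by rewrite addrACA.
Qed.

HB.instance Definition _ := GRing.Zmodule_isLmodule.Build R[i] g
  complex_scaleA complex_scale1 complex_scaleDr complex_scaleDl.

Definition complex_lie (x y : g) : g :=
  (lie x.1 y.1 - lie x.2 y.2, lie x.1 y.2 + lie x.2 y.1).

Lemma complex_lieC x y : complex_lie x y = - complex_lie y x.
Proof.
rewrite /complex_lie (lieC x.1) (lieC x.2 y.2) (lieC x.1 y.2) (lieC x.2).
by congr pair; rewrite /= opprD ?opprK // addrC.
Qed.

Lemma complex_lie_linearl k x y z : complex_lie (k *: x + y) z = k *: complex_lie x z + complex_lie y z.
Proof.
have E (l : R[i]) (u : g) : l *: u = complex_scale l u by [].
rewrite !E /complex_lie /complex_scale; case: k x y z => [a b] [x x'] [y y'] [z z'].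
congr pair; rewrite /= !lieDl !lieNl !lieZl.
  rewrite scalerBr scalerDr !opprD.
  by rewrite [LHS](AC (3*3) ((1*4)*(5*2)*(3*6))).
rewrite scalerBr scalerDr.
by rewrite [LHS](AC (3*3) ((1*4)*(5*2)*(3*6))).
Qed.

Lemma complex_lie_linearr k x y z : complex_lie z (k *: x + y) = k *: complex_lie z x + complex_lie z y.
Proof. by rewrite complex_lieC complex_lie_linearl opprD -scalerN -!complex_lieC. Qed.

Lemma complex_lie_alt x : complex_lie x x = 0.
Proof.
case: x => x y; congr pair; rewrite /= ?lie_alt ?subr0 //.
by rewrite (lieC x) addNr.
Qed.

Lemma complex_lie_jacobi x y z :
  complex_lie x (complex_lie y z) + complex_lie y (complex_lie z x) + complex_lie z (complex_lie x y) = 0.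
Proof.
have J (u v w : g0) : lie w (lie u v) = - lie u (lie v w) - lie v (lie w u).
  by apply/eqP; rewrite -opprD -addr_eq0 addrC lie_jacobi.
case: x y z => [x x'] [y y'] [z z']; congr pair; rewrite /= !(lieDr, lieNr).
  rewrite (J x y z) (J x y' z') (J x' y z') (J x' y' z) !opprD !opprK !addrA.
  rewrite [LHS](AC 16 ((1*9)*(5*10)*(4*11)*(7*12)*(2*13)*(8*14)*(3*15)*(6*16))).
  by rewrite /= !subrr !addNr !addr0.
rewrite (J x y' z) (J x y z') (J x' y z) (J x' y' z') !opprD !opprK !addrA.
rewrite [LHS](AC 16 ((1*13)*(2*9)*(3*11)*(4*15)*(5*12)*(6*14)*(7*10)*(8*16))).
by rewrite /= !subrr !addNr !addr0.
Qed.

HB.instance Definition _ := Lmodule_isLie.Build R[i] g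
  complex_lie_linearl complex_lie_linearr complex_lie_alt complex_lie_jacobi.

End Complexification.

(* The usual topology of the finite-dimensional real vector space 'End(V),
   transported from matrices; it does not depend on the basis. *)
HB.instance Definition _ (R : realType) (V : vectType R) :=
  Topological.copy 'End(V)
    (initial_topology (mxof (vbasis {:V}) (vbasis {:V}))).
HB.instance Definition _ (R : realType) (V : vectType R) :=
  isPointed.Build 'End(V) 0.

Section LinearGroups.
Variables (R : realType) (V : vectType R).
Implicit Types (X : 'End(V)) (H A G : set 'End(V)).

Definition exp_end X : 'End(V) :=
  limn (fun n => \sum_(k < n) (k`!%:R^-1 : R) *: iter k (comp_lfun X) \1%VF).

(* the Lie algebra of a closed linear group H *)
Definition lie_of H : set 'End(V) :=
  [set X | forall t : R, H (exp_end (t *: X))].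

(* dimension of a closed linear group as a Lie group: the maximal number of
   linearly independent elements of its Lie algebra *)
Definition group_dim H : nat :=
  \max_(d < (\dim {:'End(V)}).+1 |
     `[< exists2 X : d.-tuple 'End(V), free X & [set` X] `<=` lie_of H >]) d.

Definition is_subgroup G A : Prop :=
  [/\ A `<=` G, A \1%VF, (forall a b, A a -> A b -> A (a \o b)%VF) &
      forall a, A a -> A (a^-1)%VF].

Definition centralizer_in G A : set 'End(V) :=
  [set g | G g /\ forall a, A a -> (g \o a = a \o g)%VF].

(* For compact G, as is the case below, a subset of G is closed in G if and
   only if it is closed in 'End(V). *)
Definition star_subgroup G A : Prop :=
  [/\ is_subgroup G A, closed A,
      (forall a b, A a -> A b -> (a \o b = b \o a)%VF) &
      group_dim (centralizer_in G A) = group_dim A].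

Definition identity_component A : set 'End(V) := connected_component A \1%VF.

(* Hom(A, U(1)). So that two characters are equal if and only if they agree on
   A, they are extended by 1 outside A. The group law is pointwise
   multiplication: the zero of X^*(A) is [cst 1], the opposite of chi is
   [fun a => (chi a)^-1]. *)
Definition characters A : set ('End(V) -> R[i]) :=
  [set chi | [/\ forall a, A a -> `|chi a| = 1,
     forall a b, A a -> A b -> chi (a \o b)%VF = chi a * chi b,
     {within A, continuous (chi : 'End(V) -> (R[i] : numFieldType))} &
     forall a, ~ A a -> chi a = 1]].

Definition opp_character (chi : 'End(V) -> R[i]) : 'End(V) -> R[i] :=
  fun a => (chi a)^-1.

Definition res_character A (chi : 'End(V) -> R[i]) : 'End(V) -> R[i] :=
  patch (cst 1) A chi.

End LinearGroups.

Section Subspaces.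
Variables (K : comNzRingType) (L : lieAlgType K).
Implicit Types U W : set L.

Definition is_subspace U : Prop :=
  U 0 /\ forall (k : K) x y, U x -> U y -> U (k *: x + y).

(* Direct sums of subspaces of L are internal: such a sum, together with the
   independence of the summands (automatic for weight spaces). *)
Definition add_subspaces U W : set L := [set x + y | x in U & y in W].

Definition sum_subspaces I (D : set I) (U : I -> set L) : set L :=
  smallest is_subspace (\bigcup_(i in D) U i).

Definition lie_subspaces U W : set L :=
  smallest is_subspace [set lie x y | x in U & y in W].

Definition is_ideal U : Prop :=
  is_subspace U /\ forall x y, U y -> U (lie x y).

Definition centralizer U : set L := [set x | forall y, U y -> lie x y = 0].

(* L is the internal direct sum of U and W *)
Definition direct_decomposition U W : Prop :=
  add_subspaces U W = setT /\ U `&` W = [set 0].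

End Subspaces.

Section CompactLie.
Variables (R : realType) (g0 : vectLieType R).
Local Notation g := (complexification g0).
Implicit Types (A : set 'End(g0)) (chi : 'End(g0) -> R[i]).

Definition ad (x : g0) : 'End(g0) := linfun (lie x).

Definition killing (x y : g0) : R :=
  \tr (mxof (vbasis {:g0}) (vbasis {:g0}) (ad x \o ad y)%VF).

(* A real Lie algebra is compact semisimple when its Killing form is negative
   definite. *)
Definition compact_semisimple : Prop := forall x, x != 0 -> killing x x < 0.

Definition lie_aut : set 'End(g0) :=
  [set f | lker f == 0%VS /\ forall x y, f (lie x y) = lie (f x) (f y)].

Definition complex_act (a : 'End(g0)) (x : g) : g := (a x.1, a x.2).

Definition weight_space A chi : set g :=
  [set Y | forall a, A a -> complex_act a Y = chi a *: Y].

Definition roots_of A : set ('End(g0) -> R[i]) :=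
  [set alpha | [/\ characters A alpha, alpha <> cst 1 &
                   weight_space A alpha <> [set 0]]].

Local Notation res A alpha := (res_character (identity_component A) alpha).

(* R'(G,A); [res_root_space] is then g'_alpha' *)
Definition res_roots A : set ('End(g0) -> R[i]) :=
  [set res A alpha | alpha in roots_of A] `\ cst 1.

Definition res_root_space A alpha' : set g :=
  sum_subspaces [set alpha | roots_of A alpha /\ res A alpha = alpha']
    (weight_space A).

Definition g_inf A : set g :=
  add_subspaces
    (sum_subspaces (res_roots A) (res_root_space A))
    (sum_subspaces (res_roots A) (fun alpha' =>
       lie_subspaces (res_root_space A alpha')
                     (res_root_space A (opp_character alpha')))).

Definition g_fin A : set g := centralizer (g_inf A).

Definition A_ideal A (I : set g) : Prop :=
  is_ideal I /\ forall a x, A a -> I x -> I (complex_act a x).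

End CompactLie.

Arguments compact_semisimple {R} g0.
Arguments lie_aut {R} g0.

(* Main.v *)
(** Elements of A are isometries for the Killing form, which is negative
    definite on g0, so the commuting family A is diagonalizable on g: the real
    points of the span of the weight spaces form an A-stable subspace of g0, and
    a common eigenvector in the complexification of its orthogonal would be
    isotropic. Bracketing weight vectors then shows that g_inf is an ideal: only
    the products of the characters restricted to the identity component matter,
    and a product of restricted characters is either nontrivial or pairs two
    opposite restricted roots. Finally g_inf is stable under complex conjugation,
    hence is the complexification of an ideal J of g0; the Killing orthogonal of
    J is a complement of J, and it centralizes J by invariance of the form. *)

From HB Require Import structures.
Require Import Defs.
From mathcomp Require Import all_boot all_order all_algebra.
From mathcomp Require Import complex ring.
From mathcomp Require Import all_classical all_reals all_analysis.
Set Implicit Arguments.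
Unset Strict Implicit.
Unset Printing Implicit Defensive.
Import Order.TTheory GRing.Theory Num.Theory.
Import passmx numFieldNormedType.Exports.
Local Open Scope classical_set_scope.
Local Open Scope ring_scope.
Local Open Scope complex_scope.

(** * Subspaces and the Killing form *)

(** Among the [{vspace V}] contained in [P], one of maximal dimension already absorbs every line of
    [P]. This gives bases and dimensions to subspaces described by predicates. *)
Lemma vspace_of_subspace (K : fieldType) (V : vectLieType K) (P : set V) :
  is_subspace P -> exists U : {vspace V}, forall x, x \in U <-> P x.
Proof.
move=> [P0 Plin].
pose Q (d : nat) :=
  `[< exists2 U : {vspace V}, (forall x, x \in U -> P x) & \dim U = d >].
have exQ : exists d, Q d.
  exists 0%N; apply/asboolP; exists 0%VS; last by rewrite dimv0.
  by move=> x; rewrite memv0 => /eqP ->.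
have ubQ d : Q d -> (d <= \dim {:V})%N.
  by move=> /asboolP[U _ <-]; apply/dimvS/subvf.
case: (ex_maxnP exQ ubQ) => d /asboolP[U UP Ud] dmax.
exists U => x; split; first exact: UP.
move=> Px; pose W := (U + <[x]>)%VS.
have /dmax : Q (\dim W).
  apply/asboolP; exists W => // y /memv_addP[u /UP Pu [v /vlineP[k ->] ->]].
  by rewrite addrC; apply: Plin.
rewrite -Ud => dW.
have /eqP -> : (U == W)%VS by rewrite eqEdim addvSl.
by rewrite -[x]add0r memv_add ?mem0v ?memv_line.
Qed.

Section Subspace.
Variables (K : comNzRingType) (L : lieAlgType K) (P : set L).
Hypothesis Psub : is_subspace P.

Lemma subspace0 : P 0. Proof. by case: Psub. Qed.

Lemma subspaceZ k x : P x -> P (k *: x).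
Proof. by move=> Px; rewrite -[_ *: _]addr0; case: Psub => P0; apply. Qed.

Lemma subspaceD x y : P x -> P y -> P (x + y).
Proof. by move=> Px Py; rewrite -[x]scale1r; case: Psub => _; apply. Qed.

Lemma subspaceN x : P x -> P (- x).
Proof. by move=> Px; rewrite -scaleN1r; apply: subspaceZ. Qed.

End Subspace.

Lemma smallest_subspace (K : comNzRingType) (L : lieAlgType K) (G : set L) :
  is_subspace (smallest (@is_subspace K L) G).
Proof.
split=> [S [[]]//|k x y Sx Sy S [Ssub GS]].
by case: (Ssub) => _; apply; [apply: Sx|apply: Sy].
Qed.

(** The twist [s] covers semilinear maps: it is the identity for brackets and the action of [A], and
    complex conjugation for [conj_lie]. *)
Lemma subspace_preim (K : comNzRingType) (L L' : lieAlgType K) (s : K -> K)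
    (f : L -> L') (P : set L') :
  f 0 = 0 -> (forall k x y, f (k *: x + y) = s k *: f x + f y) ->
  is_subspace P -> is_subspace [set x | P (f x)].
Proof.
move=> f0 fE [P0 Plin]; split=> [|k x y Px Py] /=; first by rewrite f0.
by rewrite fE; apply: Plin.
Qed.

Lemma add_subspaces_subspace (K : comNzRingType) (L : lieAlgType K)
    (U W : set L) :
  is_subspace U -> is_subspace W -> is_subspace (add_subspaces U W).
Proof.
move=> [U0 Ulin] [W0 Wlin]; split.
  by exists 0 => //; exists 0 => //; rewrite addr0.
move=> k _ _ [u Uu [w Ww <-]] [u' Uu' [w' Ww' <-]].
exists (k *: u + u'); first exact: Ulin.
exists (k *: w + w'); first exact: Wlin.
by rewrite scalerDr addrACA.
Qed.

Section LieSubspace.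
Variables (K : comNzRingType) (L : lieAlgType K) (P : set L).
Hypothesis Psub : is_subspace P.

Lemma subspace_liel y : is_subspace [set x | P (lie x y)].
Proof.
apply: (@subspace_preim _ _ _ id (fun x => lie x y)) => //; first exact: lie0l.
by move=> k x z; rewrite lie_linearl.
Qed.

Lemma subspace_lier x : is_subspace [set y | P (lie x y)].
Proof.
apply: (@subspace_preim _ _ _ id (lie x)) => //; first exact: lie0r.
by move=> k y z; rewrite lie_linearr.
Qed.

End LieSubspace.

Lemma lie_liel (K : comNzRingType) (L : lieAlgType K) (x y z : L) :
  lie (lie x y) z = lie x (lie y z) - lie y (lie x z).
Proof.
rewrite lieC; apply/eqP; rewrite eq_sym -addr_eq0.
by rewrite -lieNr -lieC lie_jacobi.
Qed.

Section Killing.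
Variables (R : realType) (g0 : vectLieType R).
Implicit Types x y z : g0.
Local Notation e := (vbasis {:g0}).
Local Notation mx := (mxof e e).

Lemma adE x y : ad x y = lie x y.
Proof.
rewrite /ad.
have lin : linear (lie x) by move=> k u v; rewrite lie_linearr.
pose F := GRing.isLinear.Build _ _ _ _ (lie x) lin.
pose f : {linear g0 -> g0} := HB.pack (lie x : g0 -> g0) F.
by rewrite -[lie x]/(f : g0 -> g0) lfunE.
Qed.

Lemma ad_lie x y : ad (lie x y) = (ad x \o ad y)%VF - (ad y \o ad x)%VF.
Proof.
apply/lfunP => z; rewrite add_lfunE opp_lfunE !comp_lfunE !adE.
exact: lie_liel.
Qed.

Lemma mxof_compE (a b : 'End(g0)) : mx (a \o b)%VF = mx b *m mx a.
Proof. by rewrite (mxof_comp _ _ (vbasisP _)). Qed.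

Lemma killingE x y : killing x y = \tr (mx (ad y) *m mx (ad x)).
Proof. by rewrite /killing mxof_compE. Qed.

Lemma killingC x y : killing x y = killing y x.
Proof. by rewrite !killingE mxtrace_mulC. Qed.

Lemma ad_linear : linear (@ad R g0).
Proof.
by move=> k x y; apply/lfunP => z; rewrite add_lfunE scale_lfunE !adE lie_linearl.
Qed.

(** Seeing the values in the module [R^o] makes the generic lemmas on linear maps available for the
    Killing form. *)
Let killingr y x : R^o := killing x y.

Let killingr_linear y : linear (killingr y).
Proof.
move=> k x x'; rewrite /killingr !killingE ad_linear linearP /= mulmxDr.
by rewrite -scalemxAr linearP.
Qed.

HB.instance Definition _ y := GRing.isLinear.Build R g0 R^o _ (killingr y)
  (killingr_linear y).

Lemma killingDl x y z : killing (x + y) z = killing x z + killing y z.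
Proof. exact: (linearD (killingr z)). Qed.

Lemma killingBl x y z : killing (x - y) z = killing x z - killing y z.
Proof. exact: (linearB (killingr z)). Qed.

Lemma killingZl k x y : killing (k *: x) y = k * killing x y.
Proof. exact: (linearZ_LR (killingr y)). Qed.

Lemma killing0l y : killing 0 y = 0.
Proof. exact: (linear0 (killingr y)). Qed.

(** Invariance of the form: [ad] turns brackets into commutators, and the trace is cyclic. *)
Lemma killing_lie x y z : killing (lie x y) z = killing x (lie y z).
Proof.
have mxB (a b : 'End(g0)) : mx (a - b) = mx a - mx b by exact: linearB.
rewrite !killingE !ad_lie !mxB !mxof_compE mulmxBr mulmxBl.
rewrite [LHS]linearB [RHS]linearB /=; congr (_ - _); first by rewrite mulmxA.
by rewrite mulmxA mxtrace_mulC mulmxA.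
Qed.

(** An automorphism conjugates [ad x] into [ad (a x)], and traces are invariant under
    conjugation. *)
Lemma killing_aut (a : 'End(g0)) x y :
  lie_aut g0 a -> killing (a x) (a y) = killing x y.
Proof.
move=> [a_inj a_lie]; rewrite !killingE.
have [b ba] : exists b, mx b *m mx a = 1%:M.
  exists (a^-1)%VF; rewrite -mxof_compE -(mxof1 (basis_free (vbasisP _))).
  by congr mx; apply/lker0_compfV.
have adM z : mx a *m mx (ad (a z)) = mx (ad z) *m mx a.
  rewrite -!mxof_compE; congr mx; apply/lfunP => w.
  by rewrite !comp_lfunE !adE a_lie.
have adJ z : mx (ad (a z)) = mx b *m mx (ad z) *m mx a.
  by rewrite -mulmxA -adM mulmxA ba mul1mx.
rewrite !adJ mxtrace_mulC -!mulmxA (mulmxA (mx a)) (mulmx1C ba) mul1mx.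
by rewrite mxtrace_mulC -!mulmxA (mulmx1C ba) mulmx1 mxtrace_mulC.
Qed.

Hypothesis g0_compact : compact_semisimple g0.

Lemma killing_le0 x : killing x x <= 0.
Proof.
have [->|/g0_compact/ltW//] := eqVneq x 0.
by rewrite killing0l.
Qed.

Lemma killing_eq0 x : killing x x = 0 -> x = 0.
Proof.
by move=> kx; have [//|/g0_compact] := eqVneq x 0; rewrite kx ltxx.
Qed.

Lemma ad_inj0 x : (forall y, lie x y = 0) -> x = 0.
Proof.
move=> x0; apply: killing_eq0; rewrite killingE.
suff -> : ad x = 0 by rewrite linear0 mulmx0 linear0.
by apply/lfunP => y; rewrite adE zero_lfunE.
Qed.

Definition killing_perp (J : set g0) : set g0 :=
  [set x | forall y, J y -> killing x y = 0].

Lemma killing_perp_subspace J : is_subspace (killing_perp J).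
Proof.
split=> [y _|k x y px py z Jz]; first exact: (linear0 (killingr y)).
by rewrite killingDl killingZl px // py // mulr0 addr0.
Qed.

(** Pairing with a basis of [J] gives a linear map [phi] to row vectors of length $\dim J$, whose
    kernel is the orthogonal of [J]. Definiteness makes [phi] injective on [J], hence onto by
    dimension, so some [u] in [J] has the same image as [x]. *)
Lemma killing_perp_proj J x : is_subspace J ->
  exists2 u, J u & killing_perp J (x - u).
Proof.
move=> /vspace_of_subspace[U UJ].
pose b := vbasis U.
pose phi (y : g0) : 'rV[R]_(\dim U) := \row_i killing y b`_i.
have phi_lin : linear phi.
  by move=> k y z; apply/rowP => i; rewrite !mxE killingDl killingZl.
pose f : {linear g0 -> 'rV[R]_(\dim U)} :=
  HB.pack phi (GRing.isLinear.Build _ _ _ _ phi phi_lin).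
have phi0 y : phi y = 0 -> killing_perp J y.
  move=> y0 z /UJ zU; rewrite killingC (coord_vbasis zU).
  rewrite -[LHS]/(killingr y _) linear_sum.
  apply: big1 => i _; rewrite [LHS]killingZl killingC.
  by have /rowP/(_ i) := y0; rewrite !mxE => ->; rewrite mulr0.
have kerU : (U :&: lker (linfun f) = 0)%VS.
  apply/eqP; rewrite -subv0; apply/subvP => y; rewrite memv_cap memv0.
  move=> /andP[yU]; rewrite memv_ker lfunE => /eqP/phi0 y0.
  by apply/eqP/killing_eq0/y0/UJ.
have : linfun f x \in (linfun f @: U)%VS.
  suff -> : (linfun f @: U = fullv)%VS by apply: memvf.
  apply/eqP; rewrite eqEdim subvf (limg_dim_eq kerU) dimvf /dim /=.
  by rewrite mul1n.
case/memv_imgP => u uU; rewrite !lfunE => fxu.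
exists u; first exact/UJ.
by apply: phi0; rewrite -[phi _]/(f (x - u)) linearB fxu subrr.
Qed.

End Killing.

(** * Common eigenvectors *)

(** Induction on the rank of [U]. If every matrix of [M] acts on [U] as a scalar, any nonzero row
    works; otherwise [U] is cut down by an eigenspace of a non-scalar one, which the others preserve
    by commutation. *)
Lemma common_eigenvector_stable (C : numClosedFieldType) n (M : set 'M[C]_n)
    (U : 'M[C]_n) :
    (forall f g, M f -> M g -> comm_mx f g) ->
    U != 0 -> (forall f, M f -> stablemx U f) ->
  exists2 v : 'rV_n, v != 0 /\ (v <= U)%MS &
    forall f, M f -> exists c, v *m f = c *: v.
Proof.
move=> Mcomm; have [d] := ubnP (\rank U).
elim: d U => // d IHd U; rewrite ltnS => rU U0 Ustable.
case: (pselect (forall f, M f -> exists c, (U <= eigenspace f c)%MS)) => [Usc|].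
  exists (nz_row U); first by rewrite nz_row_eq0 nz_row_sub.
  move=> f /Usc[c Uc]; exists c; apply/eigenspaceP.
  exact: submx_trans (nz_row_sub _) Uc.
move=> /existsNP[f /not_implyP[Mf /forallNP Uf]].
have Ugt0 : (0 < \rank U)%N by rewrite lt0n mxrank_eq0.
have [c /eigenvalueP[v vc v0]] := eigenvalue_closed (restrictmx U f) Ugt0.
(* [v] is written in the coordinates of [row_base U]; [w] is the same vector in the ambient
   space. *)
pose w := v *m row_base U.
have wU : (w <= U)%MS by rewrite (submx_trans (submxMl _ _)) ?eq_row_base.
have wc : w *m f = c *: w.
  rewrite /w -mulmxA -[row_base U *m f](@mulmxKpV _ _ _ _ _ (row_base U)).
    by rewrite 2!mulmxA -[X in X *m _]mulmxA -[X in v *m X]/(conjmx _ _) vc scalemxAl.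
  by rewrite -[(_ <= _)%MS]/(stablemx _ _) stablemx_row_base Ustable.
pose U' := (U :&: eigenspace f c)%MS.
have wU' : (w <= U')%MS by rewrite sub_capmx wU; apply/eigenspaceP.
have w0 : w != 0.
  apply: contra v0 => /eqP w0; rewrite -(mulmxKp (row_base_free U) v).
  by rewrite -/w w0 mul0mx.
have U'U : (\rank U' < \rank U)%N.
  by apply: rank_ltmx; rewrite ltmxE capmxSl /= sub_capmx submx_refl /=; apply/negP.
case: (IHd U') => [||g Mg|u [u0 uU'] uM].
- exact: leq_trans U'U rU.
- by apply: contra w0 => /eqP U'0; rewrite U'0 submx0 in wU'.
- rewrite sub_capmx (submx_trans (submxMr _ (capmxSl _ _)) (Ustable _ Mg)).
  apply: (submx_trans (submxMr _ (capmxSr _ _))).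
  exact/comm_mx_stable_eigenspace/Mcomm.
- by exists u => //; split=> //; apply: submx_trans uU' (capmxSl _ _).
Qed.

Section RealParts.
Variable R : rcfType.
Implicit Types (c d : R[i]).
Local Notation Re := (@complex.Re R).
Local Notation Im := (@complex.Im R).

Let ReD : {morph Re : c d / c + d}. Proof. by case=> a b [a' b']. Qed.
Let ImD : {morph Im : c d / c + d}. Proof. by case=> a b [a' b']. Qed.

Lemma map_Re_mulmx m n (v : 'rV[R[i]]_m) (B : 'M[R]_(m, n)) :
  map_mx Re (v *m map_mx (real_complex R) B) = map_mx Re v *m B.
Proof.
apply/rowP => j; rewrite !mxE (big_morph Re ReD (erefl _)).
apply: eq_bigr => k _; rewrite !mxE; case: (v 0 k) => a b /=.
by rewrite mulr0 subr0.
Qed.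

Lemma map_Im_mulmx m n (v : 'rV[R[i]]_m) (B : 'M[R]_(m, n)) :
  map_mx Im (v *m map_mx (real_complex R) B) = map_mx Im v *m B.
Proof.
apply/rowP => j; rewrite !mxE (big_morph Im ImD (erefl _)).
apply: eq_bigr => k _; rewrite !mxE; case: (v 0 k) => a b /=.
by rewrite mulr0 add0r.
Qed.

Lemma map_Re_scale n c (v : 'rV[R[i]]_n) :
  map_mx Re (c *: v) = Re c *: map_mx Re v - Im c *: map_mx Im v.
Proof. by apply/rowP => j; rewrite !mxE; case: c (v 0 j) => a b []. Qed.

Lemma map_Im_scale n c (v : 'rV[R[i]]_n) :
  map_mx Im (c *: v) = Re c *: map_mx Im v + Im c *: map_mx Re v.
Proof. by apply/rowP => j; rewrite !mxE; case: c (v 0 j) => a b []. Qed.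

End RealParts.

Lemma continuous_real_complex (R : realType) :
  continuous (real_complex R : R -> (R[i] : numFieldType)).
Proof.
(* A positive complex number has zero imaginary part, so the estimate reduces to a real one. *)
move=> x; apply/cvgrPdist_lt => -[e e'] /=; rewrite ltcE /= => /andP[/eqP -> e0].
near=> y.
rewrite -rmorphB normc_def /= expr0n addr0 sqrtr_sqr ltcR.
near: y; apply: (@cvgr_dist_lt _ R^o).
Unshelve. all: by end_near. Qed.

Section ComplexAction.
Variables (R : realType) (g0 : vectLieType R).
Local Notation g := (complexification g0).
Local Notation e := (vbasis {:g0}).
Local Notation mx := (mxof e e).
Implicit Types (x y : g0) (X Y : g) (a b : 'End(g0)).

Lemma scale_pairE (k : R[i]) x y : k *: ((x, y) : g) =
  (complex.Re k *: x - complex.Im k *: y, complex.Re k *: y + complex.Im k *: x).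
Proof. by []. Qed.

Lemma lie_pairE x y x' y' : lie ((x, y) : g) (x', y') =
  (lie x x' - lie y y', lie x y' + lie y x').
Proof. by []. Qed.

Lemma complex_act_linear a (k : R[i]) X Y :
  complex_act a (k *: X + Y) = k *: complex_act a X + complex_act a Y.
Proof.
case: X Y => [x x'] [y y']; rewrite /complex_act !scale_pairE.
have aD (u v : g0) : a (u + v) = a u + a v by exact: linearD.
have aN (u : g0) : a (- u) = - a u by exact: linearN.
have aZ t (u : g0) : a (t *: u) = t *: a u by exact: linearZ.
by congr pair; rewrite /= !(aD, aN, aZ).
Qed.

Lemma continuous_killing x y : continuous (fun a : 'End(g0) => killing (a x) y).
Proof.
(* The topology of ['End(g0)] is pulled back from matrices, so the function is expanded as a linear
   combination of matrix entries of [a]. *)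
have /funext -> : (fun a : 'End(g0) => killing (a x) y) =1
    fun a => \sum_j (\sum_k rVof e x 0 k * mx a k j) * killing e`_j y.
  move=> a.
  rewrite -{1}[x](rVofK (vbasisP _)) (hom_vecof _ (vbasisP _)).
  rewrite (big_morph _ (fun u v => killingDl u v y) (killing0l y)).
  by apply: eq_bigr => j _; rewrite killingZl mxE.
move=> a; have FF : Filter (nbhs a) by exact: nbhs_filter.
apply: (@cvg_big _ _ _ _ _ _ _ (nbhs a)) => [|j _]; first exact: add_continuous.
apply: (@cvgMr_tmp _ _ (nbhs a)).
apply: (@cvg_big _ _ _ _ _ _ _ (nbhs a)) => [|k _]; first exact: add_continuous.
apply: (@cvgMl_tmp _ _ (nbhs a)).
apply: (@continuous_comp _ _ _ (mx : 'End(g0) -> _)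
  (fun M : 'M[R]_(_, _) => M k j)).
  exact: initial_continuous.
exact: coord_continuous.
Qed.

End ComplexAction.

Section Weights.
Variables (R : realType) (g0 : vectLieType R) (A : set 'End(g0)).
Hypothesis g0_compact : compact_semisimple g0.
Hypothesis A_sub : is_subgroup (lie_aut g0) A.
Local Notation g := (complexification g0).
Local Notation e := (vbasis {:g0}).
Local Notation mx := (mxof e e).
Implicit Types (x y : g0) (X Y : g) (a b : 'End(g0)).

Let A_aut a : A a -> lie_aut g0 a. Proof. by case: A_sub => + _ _ _; apply. Qed.

(* Pairing a X = c *: X with X through the Killing form recovers c as a
   continuous function of a. *)
Lemma common_eigenvector_weight X :
    X != 0 -> (forall a, A a -> exists c, complex_act a X = c *: X) ->
  exists2 chi, characters A chi & weight_space A chi X.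
Proof.
case: X => x y X0 eigX.
pose N := killing x x + killing y y.
have N0 : N != 0.
  have [kx ky] := (killing_le0 g0_compact x, killing_le0 g0_compact y).
  apply: contra X0; rewrite naddr_eq0 // => /andP[/eqP x0 /eqP y0].
  by rewrite (killing_eq0 g0_compact x0) (killing_eq0 g0_compact y0).
(* Write $X = x + iy$ and extend the Killing form $\kappa$ bilinearly over the complex numbers. Then
   $N = \kappa(X, \bar X)$, and [p a], [q a] are the real and imaginary parts of $\kappa(aX, \bar
   X)/N$. *)
pose p a := (killing (a x) x + killing (a y) y) / N.
pose q a := (killing (a y) x - killing (a x) y) / N.
pose chi a : R[i] := if a \in A then p a +i* q a else 1.
have chiW : weight_space A chi (x, y).
  move=> a Aa; have [c ac] := eigX a Aa; rewrite ac; congr (_ *: _).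
  move: ac; rewrite scale_pairE => -[ax ay].
  rewrite /chi mem_set //; case: c ax ay => c d /= ax ay.
  rewrite /p /q ax ay !killingBl !killingDl !killingZl (killingC y x).
  by congr Complex; apply: (mulIf N0); rewrite mulfVK // /N; ring.
have chi_uniq c d : c *: ((x, y) : g) = d *: ((x, y) : g) -> c = d.
  move=> /eqP; rewrite -subr_eq0 -scalerBl scaler_eq0 (negPf X0) orbF subr_eq0.
  by move/eqP.
exists chi => //; split.
(* The automorphism [a] preserves [N], while scaling $X$ by $c + id$ multiplies it by $c^2 +
   d^2$. *)
- move=> a Aa; have := chiW a Aa; case: (chi a) => c d.
  rewrite /complex_act scale_pairE => -[/= ax ay].
  have : killing (a x) (a x) + killing (a y) (a y) = N.
    by rewrite !(killing_aut _ _ (A_aut Aa)).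
  rewrite ax ay !killingBl !killingDl !killingZl.
  rewrite ![killing _ (_ - _)]killingC ![killing _ (_ + _)]killingC.
  rewrite !killingBl !killingDl !killingZl (killingC y x) => cdN.
  rewrite normc_def /= (_ : _ + _ = 1) ?sqrtr1 //.
  by apply: (mulIf N0); rewrite mul1r -[RHS]cdN /N; ring.
- move=> a b Aa Ab; apply: chi_uniq.
  have Aab : A (a \o b)%VF by case: A_sub => _ _ + _; apply.
  rewrite -(chiW _ Aab) mulrC -scalerA -(chiW _ Aa).
  rewrite -[RHS]addr0 -[0](_ : complex_act a 0 = 0); last first.
    by rewrite /complex_act /= linear0.
  rewrite -complex_act_linear addr0 -(chiW _ Ab).
  by rewrite /complex_act /= !comp_lfunE.
(* The formula for [chi] on [A] defines a function continuous on all of ['End(g0)]. *)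
- pose f a : (R[i] : numFieldType) := (p a)%:C + 'i%C * (q a)%:C.
  apply: (@subspace_eq_continuous _ _ _ f).
    by move=> a aA; rewrite -[RHS]/(chi a) /chi aA [RHS]complexE.
  apply: continuous_subspaceT => a; rewrite /f.
  have FF : Filter (nbhs a) by exact: nbhs_filter.
  apply: (@cvgD _ _ _ (nbhs a)).
    apply: (@continuous_comp _ _ _ p
      (real_complex R : R -> (R[i] : numFieldType))).
      apply: (@cvgMr_tmp _ _ (nbhs a)).
      by apply: (@cvgD _ _ _ (nbhs a)); apply: continuous_killing.
    exact: continuous_real_complex.
  apply: (@cvgMl_tmp _ _ (nbhs a)).
  apply: (@continuous_comp _ _ _ q
    (real_complex R : R -> (R[i] : numFieldType))).
    apply: (@cvgMr_tmp _ _ (nbhs a)).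
    by apply: (@cvgB _ _ _ (nbhs a)); apply: continuous_killing.
  exact: continuous_real_complex.
- by move=> a nAa; rewrite /chi memNset.
Qed.

Hypothesis A_comm : forall a b, A a -> A b -> (a \o b = b \o a)%VF.

(** The complexified matrices of [A] commute and preserve the complexification of [J], so they have
    a common eigenvector there. That space is spanned by real rows, which puts the real and
    imaginary parts of the eigenvector in [J]. *)
Lemma exists_weight_vector (J : set g0) z :
    is_subspace J -> (forall a x, A a -> J x -> J (a x)) -> J z -> z != 0 ->
  exists x y, [/\ J x, J y, (x, y) != 0 :> g &
    exists2 chi, characters A chi & weight_space A chi (x, y)].
Proof.
move=> /vspace_of_subspace[W WJ] aJ Jz z0.
pose MC (M : 'M[R]_(\dim {:g0})) := map_mx (real_complex R) M.
pose U := MC (msof e W).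
have U0 : U != 0.
  rewrite map_mx_eq0 msof_eq0 ?vbasisP //; apply: contra z0 => /eqP W0.
  by move/WJ: Jz; rewrite W0 memv0.
case: (@common_eigenvector_stable _ _ [set MC (mx a) | a in A] U) => //.
- move=> _ _ [a Aa <-] [b Ab <-].
  by rewrite /comm_mx -!map_mxM /= -!mxof_compE A_comm.
- move=> _ [a Aa <-]; rewrite -map_mxM map_submx.
  apply/rV_subP => _ /submxP[u ->].
  rewrite mulmxA -(mem_vecof (vbasisP _)) -(hom_vecof _ (vbasisP _)).
  by apply/WJ/aJ => //; apply/WJ; rewrite (mem_vecof (vbasisP _)) submxMl.
move=> v [v0 /submxP[D vD]] eigv.
pose x := vecof e (map_mx (@complex.Re R) v).
pose y := vecof e (map_mx (@complex.Im R) v).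
have xyW : J x /\ J y.
  split; apply/WJ; rewrite (mem_vecof (vbasisP _)) vD.
    by rewrite map_Re_mulmx submxMl.
  by rewrite map_Im_mulmx submxMl.
have X0 : (x, y) != 0 :> g.
  apply: contra v0 => /eqP[/eqP x0 /eqP y0].
  move: x0 y0; rewrite !vecof_eq0 ?vbasisP // => /eqP Re0 /eqP Im0.
  apply/eqP/rowP => j; move/rowP/(_ j): Re0; move/rowP/(_ j): Im0.
  by rewrite !mxE; case: (v 0 j) => ? ? /= -> ->.
exists x, y; case: xyW => Jx Jy; split=> //.
apply: common_eigenvector_weight => // a Aa.
have [|c vc] := eigv (MC (mx a)); first by exists a.
exists c; rewrite scale_pairE /complex_act /= !(hom_vecof _ (vbasisP _)).
rewrite -map_Re_mulmx -map_Im_mulmx vc map_Re_scale map_Im_scale.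
by rewrite linearB linearD /= !linearZ.
Qed.

End Weights.

(** * The decomposition *)

Section Conjugation.
Variables (R : realType) (g0 : vectLieType R).
Local Notation g := (complexification g0).
Implicit Types (x y : g0) (X Y : g) (P : set g).

Definition conj_lie X : g := (X.1, - X.2).

Lemma conj_lie_scale (k : R[i]) X Y :
  conj_lie (k *: X + Y) = k^* *: conj_lie X + conj_lie Y.
Proof.
case: X Y k => [x y] [x' y'] [a b]; rewrite /conj_lie scale_pairE; congr pair => /=.
  by rewrite scaleNr scalerN !opprK.
by rewrite scaleNr scalerN !opprD.
Qed.

Lemma conj_lie0 : conj_lie 0 = 0.
Proof. by rewrite /conj_lie /= oppr0. Qed.

Lemma conj_lieM X Y : conj_lie (lie X Y) = lie (conj_lie X) (conj_lie Y).
Proof.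
case: X Y => [x y] [x' y']; rewrite /conj_lie !lie_pairE; congr pair => /=.
  by rewrite lieNl lieNr opprK.
by rewrite lieNl lieNr opprD.
Qed.

Definition real_points P : set g0 := [set x | P (x, 0)].

Lemma real_points_subspace P : is_subspace P -> is_subspace (real_points P).
Proof.
move=> [P0 Plin]; split=> // k x y Px Py.
suff E : (k *: x + y, 0) = k%:C *: ((x, 0) : g) + (y, 0).
  by rewrite /real_points /= E; apply: Plin.
by rewrite scale_pairE; congr pair; rewrite /= ?scaler0 ?scale0r ?subr0 ?addr0.
Qed.

(** A subspace stable under conjugation is the complexification of its real points: the two
    components of $X$ are $(X + \bar X)/2$ and $(X - \bar X)/(2i)$. *)
Lemma real_pointsP P x y : is_subspace P -> (forall X, P X -> P (conj_lie X)) ->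
  P (x, y) <-> real_points P x /\ real_points P y.
Proof.
move=> Psub Pconj; split=> [Pxy|[Px Py]].
  have half (z : g0) : 2^-1 *: (z + z) = z.
    by rewrite -mulr2n -[z *+ 2]scaler_nat scalerA mulVf ?scale1r ?pnatr_eq0.
  split.
    suff E : (x, 0) = (2^-1)%:C *: (((x, y) : g) + conj_lie (x, y)).
      rewrite /real_points /= E; apply/(subspaceZ Psub)/(subspaceD Psub) => //.
      exact: Pconj.
    rewrite -[_ + _]/((x + x, y - y) : g) scale_pairE subrr.
    by rewrite /= scaler0 scale0r subr0 scaler0 add0r half.
  suff E : (y, 0) = (0 -i* 2^-1) *: (((x, y) : g) - conj_lie (x, y)).
    rewrite /real_points /= E; apply/(subspaceZ Psub)/(subspaceD Psub) => //.
    exact/(subspaceN Psub)/Pconj.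
  rewrite -[_ - _]/((x - x, y - - y) : g) scale_pairE subrr opprK.
  by rewrite /= !scale0r scaler0 addr0 scaleNr opprK add0r half.
suff -> : (x, y) = 'i%C *: ((y, 0) : g) + (x, 0).
  exact/(subspaceD Psub)/Px/(subspaceZ Psub).
rewrite scale_pairE; congr pair; rewrite /=.
  by rewrite scaler0 scale0r subr0 add0r.
by rewrite scaler0 scale1r add0r addr0.
Qed.

End Conjugation.

(** * Characters of [A] and the weight decomposition *)

Section Decomposition.
Variables (R : realType) (g0 : vectLieType R) (A : set 'End(g0)).
Hypothesis g0_compact : compact_semisimple g0.
Hypothesis A_sub : is_subgroup (lie_aut g0) A.
Hypothesis A_comm : forall a b, A a -> A b -> (a \o b = b \o a)%VF.
Local Notation g := (complexification g0).
Implicit Types (x y : g0) (X Y Z : g) (a b : 'End(g0)).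
Implicit Types (chi psi alpha beta gamma : 'End(g0) -> R[i]).
Local Notation A0 := (identity_component A).
Local Notation res := (res_character A0).

Let A_aut a : A a -> lie_aut g0 a. Proof. by case: A_sub => + _ _ _; apply. Qed.
Let A_inv a : A a -> A (a^-1)%VF. Proof. by case: A_sub => _ _ _; apply. Qed.

Let complex_act0 a : complex_act a 0 = 0 :> g.
Proof. by rewrite /complex_act /= linear0. Qed.

Lemma complex_actK a X : A a -> complex_act a (complex_act (a^-1)%VF X) = X.
Proof.
move=> /A_aut[a_inj _]; case: X => x y.
by rewrite /complex_act /= -!comp_lfunE lker0_compfV // !id_lfunE.
Qed.

Lemma complex_act_lie a X Y :
  A a -> complex_act a (lie X Y) = lie (complex_act a X) (complex_act a Y).
Proof.
move=> /A_aut[_ aM]; case: X Y => [x y] [x' y'].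
rewrite /complex_act !lie_pairE /= -!aM; congr pair; last exact: linearD.
exact: linearB.
Qed.

Lemma charactersM chi psi : characters A chi -> characters A psi ->
  characters A (fun a => chi a * psi a).
Proof.
move=> [n1 m1 c1 o1] [n2 m2 c2 o2]; split.
- by move=> a Aa; rewrite normrM n1 // n2 // mulr1.
- by move=> a b Aa Ab; rewrite m1 // m2 // mulrACA.
- by move=> a; apply: cvgM; [exact: c1|exact: c2].
- by move=> a nAa; rewrite o1 // o2 // mulr1.
Qed.

Lemma charactersV chi : characters A chi -> characters A (opp_character chi).
Proof.
rewrite /opp_character => -[n1 m1 c1 o1]; split.
- by move=> a Aa; rewrite normfV n1 // invr1.
- by move=> a b Aa Ab; rewrite m1 // invfM.
- move=> a; apply: cvgV; last exact: c1.
  have [Aa|/o1->] := pselect (A a); last exact: oner_neq0.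
  by rewrite -normr_eq0 n1 // oner_neq0.
- by move=> a nAa; rewrite o1 // invr1.
Qed.

Lemma weight_lie chi psi X Y : weight_space A chi X -> weight_space A psi Y ->
  weight_space A (fun a => chi a * psi a) (lie X Y).
Proof.
by move=> wX wY a Aa; rewrite complex_act_lie // wX // wY // lieZl lieZr scalerA.
Qed.

(** The action of [A] is real, so conjugation conjugates eigenvalues; these have modulus one, so
    their conjugates are their inverses. *)
Lemma weight_conj chi X : characters A chi -> weight_space A chi X ->
  weight_space A (opp_character chi) (conj_lie X).
Proof.
move=> [chi1 _ _ _] wX a Aa.
have -> : opp_character chi a = (chi a)^*.
  have chi0 : chi a != 0 by rewrite -normr_eq0 chi1 // oner_neq0.
  apply: (mulfI chi0); rewrite /opp_character mulfV //.
  by rewrite -[RHS]normCK chi1 // expr1n.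
have -> : complex_act a (conj_lie X) = conj_lie (complex_act a X).
  by rewrite /complex_act /conj_lie /= linearN.
by rewrite wX // -[_ *: X]addr0 conj_lie_scale conj_lie0 addr0.
Qed.

Lemma weight_span X : sum_subspaces (characters A) (weight_space A) X.
Proof.
set T := sum_subspaces _ _; have Tsub : is_subspace T by apply: smallest_subspace.
have Tweight chi Y : characters A chi -> weight_space A chi Y -> T Y.
  by move=> cchi wY; apply: sub_gen_smallest; exists chi.
have Tconj Y : T Y -> T (conj_lie Y).
  apply: (smallest_sub (X := [set Y | T (conj_lie Y)])).
    apply: (@subspace_preim _ g g (fun k => k^*)%C (@conj_lie _ g0)) => //.
      exact: conj_lie0.
    exact: conj_lie_scale.
  move=> Z [chi cchi wZ]; apply: (Tweight (opp_character chi)).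
    exact: charactersV.
  exact: weight_conj.
have Tact a Y : A a -> T Y -> T (complex_act a Y).
  move=> Aa; apply: (smallest_sub (X := [set Y | T (complex_act a Y)])).
    apply: (@subspace_preim _ g g id (complex_act a)) => //.
    exact: complex_act_linear.
  move=> Z [chi cchi wZ] /=; rewrite wZ //.
  apply: (subspaceZ Tsub).
  exact: Tweight wZ.
have Jsub := real_points_subspace Tsub.
pose J' := killing_perp (real_points T).
(* By isometry, pairing [a x] with [y] is pairing [x] with $a^{-1}y$, which is again a real point of
   [T]. *)
have J'act a x : A a -> J' x -> J' (a x).
  move=> Aa J'x y Ty; have [a_inj _] := A_aut Aa.
  have -> : y = a ((a^-1)%VF y).
    by rewrite -comp_lfunE lker0_compfV // id_lfunE.
  rewrite (killing_aut _ _ (A_aut Aa)); apply: J'x.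
  have := Tact _ _ (A_inv Aa) Ty.
  by rewrite /complex_act /= linear0.
have J'0 x : J' x -> x = 0.
  move=> J'x; have [//|x0] := eqVneq x 0.
  have [y [z [J'y J'z yz0 [chi cchi wyz]]]] :=
    exists_weight_vector g0_compact A_sub A_comm
      (killing_perp_subspace _) J'act J'x x0.
  (* Both components of the weight vector lie in the real points of [T] and in their orthogonal,
     hence are orthogonal to themselves. *)
  have /(real_pointsP _ _ Tsub Tconj)[Ty Tz] := Tweight _ _ cchi wyz.
  case/eqP: yz0; congr pair; apply: (killing_eq0 g0_compact).
    exact: J'y.
  exact: J'z.
have JT x : real_points T x.
  have [u Tu /J'0/eqP] := killing_perp_proj g0_compact x Jsub.
  by rewrite subr_eq0 => /eqP ->.
by case: X => x y; apply/real_pointsP.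
Qed.

(** * Restricted characters and the generators of [g_inf] *)

Lemma res_characterM chi psi :
  res (fun a => chi a * psi a) = fun a => res chi a * res psi a.
Proof.
by apply/funext => a; rewrite /res_character /patch; case: ifP; rewrite ?mulr1.
Qed.

Lemma res_characterV chi : res (opp_character chi) = opp_character (res chi).
Proof.
apply/funext => a; rewrite /res_character /opp_character /patch.
by case: ifP; rewrite ?invr1.
Qed.

Lemma res_root chi X : characters A chi -> res chi <> cst 1 ->
  weight_space A chi X -> X <> 0 -> roots_of A chi.
Proof.
move=> cchi rchi wX X0; split=> // [chi1|w0]; last by move: wX; rewrite w0.
apply: rchi; rewrite chi1; apply/funext => a.
by rewrite /res_character /patch if_same.
Qed.

Lemma opp_character_eq1 chi : opp_character chi = cst 1 -> chi = cst 1.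
Proof.
move=> /funeqP chi1; apply/funext => a; apply: invr_inj; rewrite invr1.
exact: chi1.
Qed.

Lemma g_inf_subspace : is_subspace (g_inf A).
Proof. by apply: add_subspaces_subspace; apply: smallest_subspace. Qed.

(** Here and in [g_inf_lie], arbitrary characters replace roots: a zero vector lies in every
    subspace, and a nonzero weight vector makes its character a root. *)
Lemma g_inf_weight chi X : characters A chi -> res chi <> cst 1 ->
  weight_space A chi X -> g_inf A X.
Proof.
move=> cchi rchi wX; have [->|/eqP X0] := eqVneq X 0.
  exact: (subspace0 g_inf_subspace).
have root_chi := res_root cchi rchi wX X0.
exists X; last first.
  by exists 0; [exact: (subspace0 (smallest_subspace _)) | rewrite addr0].
apply: sub_gen_smallest; exists (res chi); first by split=> //; exists chi.
by apply: sub_gen_smallest; exists chi.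
Qed.

Lemma g_inf_lie alpha beta X Y :
    characters A alpha -> characters A beta -> res alpha <> cst 1 ->
    res beta = opp_character (res alpha) ->
    weight_space A alpha X -> weight_space A beta Y ->
  g_inf A (lie X Y).
Proof.
move=> calpha cbeta ralpha rbeta wX wY.
have [->|/eqP X0] := eqVneq X 0.
  by rewrite lie0l; exact: (subspace0 g_inf_subspace).
have [->|/eqP Y0] := eqVneq Y 0.
  by rewrite lie0r; exact: (subspace0 g_inf_subspace).
have root_alpha := res_root calpha ralpha wX X0.
have root_beta : roots_of A beta.
  by apply: res_root wY Y0 => //; rewrite rbeta => /opp_character_eq1.
exists 0; first exact: (subspace0 (smallest_subspace _)).
exists (lie X Y); last by rewrite add0r.
apply: sub_gen_smallest; exists (res alpha); first by split=> //; exists alpha.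
apply: sub_gen_smallest; exists X; first by apply: sub_gen_smallest; exists alpha.
by exists Y => //; apply: sub_gen_smallest; exists beta.
Qed.

(** The nested spans defining [g_inf] are peeled off one by one; for brackets, first the left factor
    is reduced to a weight vector, then the right one. *)
Lemma g_inf_ind (P : set g) : is_subspace P ->
    (forall chi X, characters A chi -> res chi <> cst 1 ->
       weight_space A chi X -> P X) ->
    (forall alpha beta X Y, characters A alpha -> characters A beta ->
       res alpha <> cst 1 -> res beta = opp_character (res alpha) ->
       weight_space A alpha X -> weight_space A beta Y -> P (lie X Y)) ->
  g_inf A `<=` P.
Proof.
move=> Psub Pweight Plie _ [X + [Y + <-]] => inX inY.
apply: (subspaceD Psub).
  apply: smallest_sub inX => // X1 [alpha' [_ res1]].
  apply: smallest_sub => // X2 [alpha [[calpha _ _] ralpha]].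
  by apply: Pweight => //; rewrite ralpha.
apply: smallest_sub inY => // Z [alpha' [_ res1]].
apply: smallest_sub => // _ [X' inX' [Y' inY' <-]].
apply: (smallest_sub (X := [set X | P (lie X Y')])) inX'.
  exact: subspace_liel.
move=> X1 [alpha [[calpha _ _] ralpha] wX1] /=.
apply: (smallest_sub (X := [set Y | P (lie X1 Y)])) inY'.
  exact: subspace_lier.
move=> Y1 [beta [[cbeta _ _] rbeta] wY1] /=.
by apply: (Plie alpha beta) => //; rewrite ralpha.
Qed.

Lemma g_inf_ideal X Y : g_inf A Y -> g_inf A (lie X Y).
Proof.
have Isub := g_inf_subspace.
have E (Z U V : g) : lie Z (lie U V) = lie (lie Z U) V + lie U (lie Z V).
  by rewrite lie_liel subrK.
move=> inY.
apply: (smallest_sub (X := [set X | g_inf A (lie X Y)])) (weight_span X).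
  exact: subspace_liel.
move=> {}X [gamma cgamma wX] /=.
move: Y inY; apply: g_inf_ind; first exact: subspace_lier.
  move=> chi Y cchi rchi wY /=.
  (* If the product restricts nontrivially, the bracket is a weight vector of [g_inf]. Otherwise the
     two restrictions are opposite and the bracket is a generator of the second kind. *)
  have [r1|r1] := pselect (res (fun a => gamma a * chi a) = cst 1); last first.
    apply: g_inf_weight r1 (weight_lie wX wY); exact: charactersM.
  have rchiE : res chi = opp_character (res gamma).
    apply/funext => a; move: r1; rewrite res_characterM => /funeqP/(_ a) /= r1.
    rewrite /opp_character -[LHS]mul1r -[X in X * _](mulVf (x := res gamma a)).
      by rewrite -mulrA r1 mulr1.
    by apply/eqP => r0; move/eqP: r1; rewrite r0 mul0r eq_sym oner_eq0.
  apply: (g_inf_lie cgamma cchi) => // r2.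
  by apply: rchi; rewrite rchiE r2; apply/funext => a; rewrite /opp_character invr1.
move=> alpha beta U V calpha cbeta ralpha rbeta wU wV /=.
(* The restrictions of [alpha] and [beta] cancel, so the double bracket has restricted character
   [res gamma]. *)
have [r1|r1] := pselect (res gamma = cst 1); last first.
  apply: g_inf_weight (weight_lie wX (weight_lie wU wV)).
    exact/charactersM/charactersM.
  rewrite !res_characterM rbeta; apply: contra_not r1 => r1.
  apply/funext => a; move/funeqP/(_ a): r1; rewrite /opp_character /=.
  have [->|r0] := eqVneq (res alpha a) 0.
    by rewrite mul0r mulr0 => /esym/eqP; rewrite oner_eq0.
  by rewrite divff // mulr1.
(* Now [gamma] is trivial on the identity component: bracketing [U] or [V] with [X] leaves their
   restricted characters unchanged, and the derivation rule gives two brackets of opposite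
   restricted weights. *)
rewrite E; apply: (subspaceD Isub).
  apply: (g_inf_lie (charactersM cgamma calpha) cbeta _ _ (weight_lie wX wU)) => //.
    by rewrite res_characterM r1; under eq_fun do rewrite mul1r.
  by rewrite res_characterM r1; under [in RHS]eq_fun do rewrite mul1r.
apply: (g_inf_lie calpha (charactersM cgamma cbeta) _ _ wU (weight_lie wX wV)) => //.
by rewrite res_characterM r1; under eq_fun do rewrite mul1r.
Qed.

Lemma g_inf_act a X : A a -> g_inf A X -> g_inf A (complex_act a X).
Proof.
move=> Aa; have Isub := g_inf_subspace; move: X; apply: g_inf_ind.
- apply: (@subspace_preim _ g g id (complex_act a)) => // *.
  exact: complex_act_linear.
- move=> chi X cchi rchi wX /=; rewrite wX //.
  by apply: (subspaceZ Isub); apply: g_inf_weight wX.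
- move=> alpha beta X Y calpha cbeta ralpha rbeta wX wY /=.
  rewrite (weight_lie wX wY) //.
  by apply: (subspaceZ Isub); apply: g_inf_lie wX wY.
Qed.

(** Conjugation replaces each character by its opposite, which preserves both nontriviality of the
    restriction and the pairing of opposite ones. *)
Lemma g_inf_conj X : g_inf A X -> g_inf A (conj_lie X).
Proof.
have Isub := g_inf_subspace; move: X; apply: g_inf_ind.
- apply: (@subspace_preim _ g g (fun k => k^*)%C (@conj_lie _ g0)) => //.
    exact: conj_lie0.
  exact: conj_lie_scale.
- move=> chi X cchi rchi wX /=.
  apply: g_inf_weight (charactersV cchi) _ (weight_conj cchi wX).
  by rewrite res_characterV => /opp_character_eq1.
- move=> alpha beta X Y calpha cbeta ralpha rbeta wX wY /=; rewrite conj_lieM.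
  apply: g_inf_lie (charactersV calpha) (charactersV cbeta) _ _
    (weight_conj calpha wX) (weight_conj cbeta wY).
    by rewrite res_characterV => /opp_character_eq1.
  by rewrite !res_characterV rbeta.
Qed.

(** * The real ideal underlying [g_inf] and its orthogonal complement *)

Let J := real_points (g_inf A).

Let Jsub : is_subspace J. Proof. exact/real_points_subspace/g_inf_subspace. Qed.

Let g_infP x y : g_inf A (x, y) <-> J x /\ J y.
Proof. exact: (real_pointsP _ _ g_inf_subspace g_inf_conj). Qed.

Let J_ideal x y : J y -> J (lie x y).
Proof.
move=> Jy; have := g_inf_ideal ((x, 0) : g) Jy.
by rewrite lie_pairE !lie0r lie0l subr0 addr0.
Qed.

(** By invariance $\kappa([w,y],[w,y]) = \kappa(w,[y,[w,y]])$, which vanishes because $[y,[w,y]]$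
    lies in the ideal [J]; definiteness concludes. *)
Let J_perp_lie w y : killing_perp J w -> J y -> lie w y = 0.
Proof.
move=> Jw Jy; apply: (killing_eq0 g0_compact); rewrite killing_lie.
exact/Jw/J_ideal/J_ideal.
Qed.

Lemma g_fin_ideal : is_ideal (g_fin A).
Proof.
split; first split=> [Z _|k X Y fX fY Z iZ].
- exact: lie0l.
- by rewrite lie_linearl fX // fY // scaler0 addr0.
- move=> X Y fY Z iZ.
  by rewrite lie_liel fY // fY ?lie0r ?subrr //; apply: g_inf_ideal.
Qed.

Lemma g_inf_fin_direct : direct_decomposition (g_inf A) (g_fin A).
Proof.
split.
  (* Both components are projected onto [J]; the remainders are orthogonal to [J] and therefore
     centralize it. *)
  apply/seteqP; split=> // -[x y] _.
  have [u Ju Jxu] := killing_perp_proj g0_compact x Jsub.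
  have [v Jv Jyv] := killing_perp_proj g0_compact y Jsub.
  exists (u, v); first exact/g_infP.
  exists (x - u, y - v); last first.
    by congr pair; rewrite /= addrC subrK.
  move=> -[s t] /g_infP[Js Jt]; rewrite lie_pairE.
  by rewrite !J_perp_lie // subr0 addr0.
apply/seteqP; split=> [[x y] [/g_infP[Jx Jy] fxy]|_ ->]; last first.
  by split; [exact: (subspace0 g_inf_subspace)|move=> Z _; exact: lie0l].
(* [x] and [y] commute with [J] because the pair lies in [g_fin], and with the orthogonal of [J]
   because they lie in [J]. So they are central in [g0], whose center is zero. *)
have lie0 z : lie x z = 0 /\ lie y z = 0.
  have [u Ju Jzu] := killing_perp_proj g0_compact z Jsub.
  have : g_inf A (u, 0) by [].
  move=> /fxy; rewrite lie_pairE !lie0r subr0 add0r => -[xu yu].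
  rewrite -[z](subrK u); move: (z - u) Jzu => w Jw; rewrite !lieDr xu yu !addr0.
  by rewrite lieC (lieC y) !J_perp_lie // oppr0.
by congr pair; apply: (ad_inj0 g0_compact) => z; case: (lie0 z).
Qed.

(** Since $[aX, Y] = a[X, a^{-1}Y]$, stability of [g_inf] under $a^{-1}$ suffices. *)
Lemma g_fin_act a X : A a -> g_fin A X -> g_fin A (complex_act a X).
Proof.
move=> Aa fX Y iY; rewrite -(complex_actK Y Aa) -complex_act_lie //.
by rewrite fX ?complex_act0 //; apply/g_inf_act/iY/A_inv.
Qed.

End Decomposition.

Theorem theorem1p5 (R : realType) (g0 : vectLieType R) (A : set 'End(g0)) :
  compact_semisimple g0 ->
  star_subgroup (lie_aut g0) A ->
  [/\ A_ideal A (g_inf A), A_ideal A (g_fin A) &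
      direct_decomposition (g_inf A) (g_fin A)].
Proof.
move=> g0_compact [A_sub _ A_comm _]; split.
- split; last exact: g_inf_act.
  by split; [exact: g_inf_subspace|exact: g_inf_ideal].
- by split; [exact: g_fin_ideal|exact: g_fin_act].
- exact: g_inf_fin_direct.
Qed.
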